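(* For every real number $\alpha$ with $1<\alpha\le 2$ there exists a positive integer $n_0$ such that for all integers $n\ge n_0$ there exists a prime $p$ with $n<p\le[\alpha n]$.
   Context: $[q]$ denotes the integral part of the real number $q$. *)

(* Defs.v *)
From mathcomp Require Export all_boot all_order all_algebra.
From mathcomp Require Export reals.

(* Main.v *)
(* Selberg's symmetry formula
     ln N * psi N + sum_(k <= N) Lambda k * psi (N / k) = 2 N ln N + O(N)
   and Erdos's gap argument.  By the formula psi has upper density at most 2, and
   an interval of ratio lam on which psi has density 0 forces density 2 on most of
   the shrunk intervals (N / k, M / k], k being weighted by Lambda k / k.  The good
   k cannot all cluster, again because the density is at most 2, so two of these
   shrunk intervals overlap without coinciding and their union is a longer
   interval of density 2.  The formula applied to this union yields an interval
   of density 0 with ratio larger than lam by a fixed factor.  Iterating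
   contradicts Mertens' estimate sum_(k <= N) Lambda k / k = ln N + O(1).
   Hence psi grows by a positive proportion of N on (N, lam N] for every lam > 1,
   which prime powers alone cannot achieve. *)
Require Import Defs.
From mathcomp Require Import all_boot all_order all_algebra reals.
From mathcomp Require Import classical_sets sequences exp ring lra.

Set Implicit Arguments.
Unset Strict Implicit.
Unset Printing Implicit Defensive.

Import Order.TTheory GRing.Theory Num.Theory.
Local Open Scope ring_scope.

(** * Sums over divisors, Moebius and von Mangoldt functions *)

Section DivisorSums.
Variable R : realType.
Implicit Types (a h : nat -> R) (N d k p : nat).

Lemma sum_multiples h d N : (0 < d)%N ->
  \sum_(1 <= k < N.+1 | (d %| k)%N) h k = \sum_(1 <= e < (N %/ d).+1) h (d * e)%N.
Proof.
move=> d0; elim: N => [|N IH]; first by rewrite div0n !big_geq.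
rewrite big_mkcond big_nat_recr //= -big_mkcond IH divnS //.
case: ifP => [dN|_]; last by rewrite add0n addr0.
rewrite add1n [RHS]big_nat_recr //=; congr (_ + h _).
by rewrite -[in LHS](divnK dN) divnS // dN mulnC.
Qed.

Lemma exchange_divisors a h N :
  \sum_(1 <= k < N.+1) h k * \sum_(1 <= d < k.+1 | (d %| k)%N) a d =
  \sum_(1 <= d < N.+1) a d * \sum_(1 <= e < (N %/ d).+1) h (d * e)%N.
Proof.
transitivity (\sum_(1 <= k < N.+1) \sum_(1 <= d < N.+1 | (d %| k)%N) a d * h k).
  apply: eq_big_nat => k /andP[k1 kN]; rewrite mulr_sumr.
  rewrite [RHS](@big_cat_nat _ _ _ k.+1) //= [X in _ = _ + X]big1_seq ?addr0.
    by apply: eq_bigr => d _; rewrite mulrC.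
  move=> d; rewrite mem_index_iota => /andP[dk /andP[kd _]].
  by move/dvdn_leq: dk => /(_ k1); rewrite leqNgt kd.
rewrite (exchange_big_dep_nat xpredT) //=.
apply: eq_big_nat => d /andP[d1 _].
by rewrite -mulr_sumr sum_multiples.
Qed.

(** Both sides run over the pairs with [d * e <= N], the lattice points under Dirichlet's
    hyperbola. *)
Lemma exchange_hyperbola a h N :
  \sum_(1 <= d < N.+1) a d * (\sum_(1 <= e < (N %/ d).+1) h e) =
  \sum_(1 <= e < N.+1) h e * (\sum_(1 <= d < (N %/ e).+1) a d).
Proof.
have aux f g M : (M <= N)%N -> forall d, (0 < d)%N -> M = (N %/ d)%N ->
    f d * (\sum_(1 <= e < M.+1) g e) =
    \sum_(1 <= e < N.+1 | (d * e <= N)%N) f d * g e :> R.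
  move=> MN d d0 ME; rewrite mulr_sumr [RHS](@big_cat_nat _ _ _ M.+1) //=.
  rewrite [X in _ = _ + X]big1_seq ?addr0.
    rewrite [RHS]big_nat_cond [LHS]big_nat_cond; apply: eq_bigl => e.
    by case: (boolP (0 < e < M.+1)%N) => //= /andP[_]; rewrite ME ltnS leq_divRL // mulnC => ->.
  move=> e; rewrite mem_index_iota => /andP[deN /andP[Me _]].
  by move: Me; rewrite ME ltnNge leq_divRL // mulnC deN.
under eq_big_nat => d /andP[d1 _] do rewrite (aux a h) ?leq_div //.
rewrite (exchange_big_dep_nat xpredT) //=.
apply: eq_big_nat => e /andP[e1 _]; rewrite (aux h a) ?leq_div //.
by apply: eq_big => [d|d _]; rewrite 1?mulnC 1?mulrC.
Qed.

End DivisorSums.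

(** * The Moebius function and its sums over divisors *)

Section Moebius.

(** Squarefreeness is read off the exponents [logn p n]. At 0 the list of primes is empty and the
    value is 1, so the sums below start at 1. *)
Definition moebius (n : nat) : int :=
  if all (fun p => logn p n == 1%N) (primes n) then (-1) ^+ size (primes n) else 0.

Lemma moebius_norm n : `|moebius n| <= 1.
Proof. by rewrite /moebius; case: ifP; rewrite ?normrX ?normrN ?normr1 ?expr1n ?normr0. Qed.

Lemma moebius_prime_mul p e : prime p -> (0 < e)%N ->
  moebius (p * e) = if (p %| e)%N then 0 else - moebius e.
Proof.
move=> pp e0; have p0 := prime_gt0 pp.
case: ifP => [pe|/negbT npe].
  rewrite /moebius; case: ifP => // /allP /(_ p).
  rewrite mem_primes pp muln_gt0 p0 e0 dvdn_mulr // => /(_ isT).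
  by rewrite lognM // (logn_prime p pp) eqxx add1n eqSS -leqn0 leqNgt logn_gt0 mem_primes pp e0 pe.
have Ppe : perm_eq (primes (p * e)) (p :: primes e).
  apply: uniq_perm; rewrite ?primes_uniq //=.
    by rewrite primes_uniq mem_primes (negbTE npe) !andbF.
  by move=> q; rewrite primesM // primes_prime // !inE.
rewrite /moebius (perm_all _ Ppe) (perm_size Ppe) /=.
have -> : logn p (p * e) == 1%N.
  by rewrite lognM // (logn_prime p pp) eqxx eqSS -leqn0 leqNgt logn_gt0 mem_primes (negbTE npe) !andbF.
rewrite andTb.
have -> : all (fun q => logn q (p * e) == 1%N) (primes e) = all (fun q => logn q e == 1%N) (primes e).
  apply: eq_in_all => q qe; rewrite lognM // (logn_prime q pp).
  by case: (eqVneq q p) qe => [->|_ _ //]; rewrite mem_primes (negbTE npe) !andbF.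
by case: ifP => _; rewrite ?exprS ?mulN1r ?oppr0.
Qed.

Variable R : realType.
Implicit Types (g : nat -> R).

(* Each divisor e prime to p is paired with p e; divisors divisible by p^2 do not
   contribute. *)
Lemma sum_moebius_prime g p k : prime p -> (p %| k)%N -> (0 < k)%N ->
  \sum_(1 <= d < k.+1 | (d %| k)%N) (moebius d)%:~R * g d =
  \sum_(1 <= e < k.+1 | (e %| k)%N && ~~ (p %| e)%N) (moebius e)%:~R * (g e - g (p * e)%N).
Proof.
move=> pp pk k0; have p0 := prime_gt0 pp.
rewrite (bigID (fun d => (p %| d)%N)) /= addrC.
under [RHS]eq_bigr => e _ do rewrite mulrBr.
rewrite [RHS]sumrB; congr (_ + _).
rewrite (eq_bigl (fun d => (p %| d)%N && (d %| k)%N)); last by move=> d; rewrite andbC.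
rewrite big_mkcondr /= sum_multiples //.
rewrite -sumrN [RHS]big_mkcond [RHS](@big_cat_nat _ _ _ (k %/ p).+1) ?ltnS ?leq_div //=.
rewrite [X in _ = _ + X]big1_seq ?addr0.
  apply: eq_big_nat => e /andP[e1 _].
  have -> : (p * e %| k)%N = (e %| k)%N && (p * e %| k)%N.
    case: (boolP (p * e %| k)%N) => h; rewrite ?andbF // (dvdn_trans _ h) //.
    by rewrite dvdn_mull.
  rewrite moebius_prime_mul //.
  case: (boolP (p %| e)%N) => pe; first by rewrite andbF mul0r; case: ifP.
  rewrite andbT Gauss_dvd ?pk //=; last by rewrite prime_coprime.
  by rewrite andbb; case: ifP => // _; rewrite rmorphN mulNr.
move=> e; rewrite mem_index_iota => /andP[_ /andP[ke ek]].
case: ifP => // /andP[ek' pe].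
have : (p * e %| k)%N by rewrite Gauss_dvd ?pk // prime_coprime.
by move/dvdn_leq => /(_ k0); rewrite mulnC -leq_divRL // leqNgt ke.
Qed.

(** With [g] constant, every pair in [sum_moebius_prime] cancels as soon as [k] has a prime
    divisor. *)
Lemma sum_moebius k : (0 < k)%N ->
  \sum_(1 <= d < k.+1 | (d %| k)%N) (moebius d)%:~R = (k == 1%N)%:R :> R.
Proof.
move=> k0; have [->|k1] := eqVneq k 1%N.
  by rewrite big_mkcond big_nat1 dvd1n.
have pp : prime (pdiv k) by rewrite pdiv_prime // ltn_neqAle eq_sym k1.
transitivity (\sum_(1 <= d < k.+1 | (d %| k)%N) (moebius d)%:~R * (fun=> 1) d : R).
  by apply: eq_bigr => d _; rewrite mulr1.
rewrite (sum_moebius_prime _ pp) ?pdiv_dvd //.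
by apply: big1 => e _; rewrite subrr mulr0.
Qed.

End Moebius.

(** * The von Mangoldt function: Moebius sum of logarithms and divisor sum *)

Section Mangoldt.
Variable R : realType.

(** [primes] lists distinct prime divisors, so a one-element list detects a prime power; at 0 and 1
    the list is empty. *)
Definition mangoldt (n : nat) : R := if primes n is [:: p] then ln p%:R else 0.

Lemma ln_nat_ge0 n : 0 <= ln (n%:R : R).
Proof. by case: n => [|n]; [rewrite ln0 | rewrite ln_ge0 // ler1n]. Qed.

Lemma lnM_nat m n : (0 < m)%N -> (0 < n)%N ->
  ln ((m * n)%:R : R) = ln m%:R + ln n%:R.
Proof. by move=> m0 n0; rewrite natrM lnM // posrE ltr0n. Qed.

Lemma ler_ln_nat m n : (0 < m)%N -> (m <= n)%N -> ln (m%:R : R) <= ln n%:R.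
Proof. by move=> m0 mn; rewrite ler_ln ?posrE ?ltr0n ?(leq_trans m0) // ler_nat. Qed.

Lemma mangoldt_ge0 n : 0 <= mangoldt n.
Proof. by rewrite /mangoldt; case: (primes n) => [|p [|]] // ; rewrite ln_nat_ge0. Qed.

Lemma mangoldt_le_ln n : mangoldt n <= ln n%:R.
Proof.
rewrite /mangoldt; case E: (primes n) => [|p [|q s]]; rewrite ?ln_nat_ge0 //.
have : p \in primes n by rewrite E mem_head.
rewrite mem_primes => /and3P[/prime_gt0 p0 n0 pn].
by rewrite ler_ln_nat // dvdn_leq.
Qed.

Lemma primes1_pfactor n p : primes n = [:: p] -> n = (p ^ logn p n)%N.
Proof.
move=> E; have : p \in primes n by rewrite E mem_head.
rewrite mem_primes => /and3P[pp n0 pn].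
rewrite -p_part part_pnat_id //; apply/pnatP => // q pq qn.
by have : q \in primes n by [rewrite mem_primes pq n0 qn]; rewrite E !inE.
Qed.

Lemma primes_partC p s n : primes n = p :: s -> (n`_p^' == 1)%N = (s == [::]).
Proof.
move=> E; have : p \in primes n by rewrite E mem_head.
rewrite mem_primes => /and3P[pp n0 pn].
rewrite partn_eq1 //.
case: s E => [|q s] E; rewrite ?eqxx /=.
  apply/pnatP => // q pq qn; rewrite inE /= negbK.
  by have : q \in primes n by [rewrite mem_primes pq n0 qn]; rewrite E !inE.
apply/negbTE/negP => /pnatP => /(_ n0 q).
have : q \in primes n by rewrite E !inE eqxx orbT.
rewrite mem_primes => /and3P[-> _ ->] => /(_ isT isT).
rewrite inE /= negbK inE => /eqP qp.
by have := primes_uniq n; rewrite E qp /= mem_head.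
Qed.

(** Pairing [e] with [p * e] for a prime [p] dividing [k] leaves [- ln p] times the Moebius sum over
    the divisors of the p'-part of [k]. That sum is 1 if [k] is a power of [p] and 0 otherwise. *)
Lemma sum_moebius_ln k : (0 < k)%N ->
  \sum_(1 <= d < k.+1 | (d %| k)%N) (moebius d)%:~R * ln d%:R = - mangoldt k.
Proof.
move=> k0; have [->|k1] := eqVneq k 1%N.
  by rewrite big_mkcond big_nat1 dvd1n ln1 mulr0 /mangoldt oppr0.
case E: (primes k) => [|p s].
  by move/eqP: E; rewrite primes_eq0; case: k k0 k1 => [|[|]].
have : p \in primes k by rewrite E mem_head.
rewrite mem_primes => /and3P[pp _ pk]; have p0 := prime_gt0 pp.
rewrite (sum_moebius_prime _ pp pk k0).
transitivity (- ln (p%:R : R) *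
    \sum_(1 <= e < k.+1 | (e %| k)%N && ~~ (p %| e)%N) (moebius e)%:~R).
  rewrite mulr_sumr [LHS]big_nat_cond [RHS]big_nat_cond; apply: eq_bigr => e.
  by case/andP=> /andP[e0 _] _; rewrite lnM_nat // opprD addrC subrK mulrC.
have Ee e : (0 < e)%N -> (e %| k)%N && ~~ (p %| e)%N = (e %| k`_p^')%N.
  move=> e0; apply/idP/idP => [/andP[ek pe]|ek].
    move: ek; rewrite -{1}(partnC p k0) Gauss_dvdr // p_part coprime_sym coprimeXl //.
    by rewrite prime_coprime.
  rewrite (dvdn_trans ek) ?dvdn_part //=; apply/negP => pe.
  have /pnatP := part_pnat (p^') k.
  by rewrite part_gt0 => /(_ isT p pp (dvdn_trans pe ek)); rewrite !inE /= eqxx.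
rewrite big_nat_cond.
rewrite (eq_bigl (fun e => (0 < e < k.+1)%N && (e %| k`_p^')%N)); last first.
  by move=> e; case: (boolP (0 < e < k.+1)%N) => //= /andP[e0 _]; exact: Ee.
rewrite -big_nat_cond (@big_cat_nat _ _ _ (k`_p^').+1) /=; last first.
- by rewrite ltnS dvdn_leq // dvdn_part.
- by [].
rewrite [X in _ + X]big1_seq ?addr0; last first.
  move=> e; rewrite mem_index_iota => /andP[ek /andP[ke _]].
  by move: ek => /dvdn_leq; rewrite part_gt0 => /(_ isT); rewrite leqNgt ke.
rewrite sum_moebius ?part_gt0 // (primes_partC E) /mangoldt E.
by case: (s) => [|q s'] /=; rewrite ?mulr1 ?mulr0 ?oppr0.
Qed.

(** Strong induction through [k = p * k']: among the divisors of [k] that do not divide [k'], only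
    the full power of [p] is a prime power, and it adds [ln p]. *)
Lemma sum_mangoldt k : (0 < k)%N ->
  \sum_(1 <= d < k.+1 | (d %| k)%N) mangoldt d = ln k%:R.
Proof.
elim/ltn_ind: k => k IH k0; have [->|k1] := eqVneq k 1%N.
  by rewrite big_mkcond big_nat1 dvd1n ln1 /mangoldt.
have pp : prime (pdiv k) by rewrite pdiv_prime // ltn_neqAle eq_sym k1.
set p := pdiv k in pp *; have p0 := prime_gt0 pp.
have [k' Ek] : exists k', k = (p * k')%N.
  by exists (k %/ p)%N; rewrite mulnC divnK // pdiv_dvd.
have k'0 : (0 < k')%N by move: k0; rewrite Ek muln_gt0 => /andP[].
have k'k : (k' < k)%N by rewrite Ek ltn_Pmull // prime_gt1.
set v := logn p k.
have Ev : v = (logn p k').+1 by rewrite /v Ek lognM // (logn_prime p pp) eqxx.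
have pvk : (p ^ v %| k)%N by rewrite pfactor_dvdn.
rewrite (bigID (fun d => (d %| k')%N)) /= [in RHS]Ek lnM_nat // addrC; congr (_ + _).
  have pvk' : ~~ (p ^ v %| k')%N by rewrite Ev pfactor_dvdn // ltnn.
  rewrite big_mkcond (bigD1_seq (p ^ v)%N) ?iota_uniq //=; last first.
    by rewrite mem_index_iota expn_gt0 p0 ltnS dvdn_leq.
  rewrite pvk pvk' big1_seq ?addr0 => [|d /andP[dv _]].
    by rewrite /mangoldt Ev primesX // primes_prime.
  case: ifP => // /andP[dk dk'].
  rewrite /mangoldt; case E: (primes d) => [|q [|]] //.
  have d0 := dvdn_gt0 k0 dk.
  have : q \in primes d by rewrite E mem_head.
  rewrite mem_primes => /and3P[pq _ qd].
  have Ed := primes1_pfactor E.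
  have := dk; rewrite {1}Ed pfactor_dvdn // => qk.
  have := dk'; rewrite {1}Ed pfactor_dvdn // -ltnNge => qk'.
  have Eq : q = p.
    apply/eqP; apply: contraTT (leq_trans qk' qk) => qp.
    by rewrite Ek lognM // (logn_prime q pp) (negbTE qp) ltnn.
  subst q; case/negP: dv; rewrite Ed; apply/eqP; congr (_ ^ _)%N.
  by apply/eqP; rewrite eqn_leq qk Ev.
rewrite -IH // [LHS](@big_cat_nat _ _ _ k'.+1) //=; last by rewrite ltnS ltnW.
rewrite [X in _ + X]big1_seq ?addr0; last first.
  move=> e; rewrite mem_index_iota => /andP[/andP[_ ek] /andP[ke _]].
  by move: ek => /dvdn_leq => /(_ k'0); rewrite leqNgt ke.
apply: eq_bigl => d; rewrite andb_idl // => dk'.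
by rewrite Ek dvdn_mull.
Qed.

End Mangoldt.

(** * Estimates of Stirling, Chebyshev and Mertens *)

Section Chebyshev.
Variable R : realType.
Implicit Types (N n k d e : nat) (x y t : R).

Lemma ln_le_subr1 x : 0 < x -> ln x <= x - 1.
Proof. by move=> x0; rewrite -{1}(addrNK 1 x) addrC le_ln1Dx //; lra. Qed.

Lemma ln_ge_1subV x : 0 < x -> 1 - x^-1 <= ln x.
Proof.
move=> x0; have := @ln_le_subr1 x^-1; rewrite invr_gt0 => /(_ x0).
by rewrite lnV ?posrE //; lra.
Qed.

Lemma ln_succ_upper n : (0 < n)%N -> n%:R * (ln (n.+1%:R : R) - ln n%:R) <= 1.
Proof.
move=> n0; have n0' : (0 : R) < n%:R by rewrite ltr0n.
rewrite -ln_div ?posrE ?ltr0n //.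
have := @ln_le_subr1 (n.+1%:R / n%:R); rewrite divr_gt0 ?ltr0n // => /(_ isT) h.
apply: le_trans (ler_wpM2l (ltW n0') h) _.
by rewrite mulrBr mulrC divfK ?gt_eqF // -natr1; lra.
Qed.

Lemma ln_succ_lower n : (0 < n)%N -> 1 <= n.+1%:R * (ln (n.+1%:R : R) - ln n%:R).
Proof.
move=> n0; have n0' : (0 : R) < n.+1%:R by rewrite ltr0n.
rewrite -ln_div ?posrE ?ltr0n //.
have := @ln_ge_1subV (n.+1%:R / n%:R); rewrite divr_gt0 ?ltr0n // => /(_ isT) h.
apply: le_trans _ (ler_wpM2l (ltW n0') h).
by rewrite invf_div mulrBr mulrCA divff ?gt_eqF // -natr1; lra.
Qed.

Lemma ln_factE N : ln (N`!%:R : R) = \sum_(1 <= k < N.+1) ln k%:R.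
Proof.
elim: N => [|N IH]; first by rewrite big_geq // ln1.
by rewrite factS lnM_nat ?fact_gt0 // IH [RHS]big_nat_recr //= addrC.
Qed.

Lemma ln_fact_lower N : N%:R * ln (N%:R : R) - N%:R <= ln N`!%:R.
Proof.
elim: N => [|[|N] IH]; first by rewrite ln1 mul0r subrr.
  by rewrite ln1; lra.
rewrite factS lnM_nat ?fact_gt0 //.
have := @ln_succ_upper N.+1 isT; rewrite mulrBr => h.
apply: le_trans (lerD (lexx _) IH); rewrite -!(natr1 N.+1).
move: h; rewrite -!(natr1 N.+1); nra.
Qed.

Lemma ln_fact_upper N : (0 < N)%N ->
  ln N`!%:R <= N%:R * ln (N%:R : R) - N%:R + 1 + ln N%:R.
Proof.
elim: N => [//|[|N] IH] _; first by rewrite ln1; lra.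
rewrite factS lnM_nat ?fact_gt0 //.
have := @ln_succ_lower N.+1 isT; rewrite mulrBr => h.
apply: le_trans (lerD (lexx _) (IH isT)) _; rewrite -!(natr1 N.+1).
move: h; rewrite -!(natr1 N.+1); nra.
Qed.

(** Legendre's formula: each [ln k] splits over the divisors of [k], and [N %/ d] integers up to [N]
    are multiples of [d]. *)
Lemma sum_mangoldt_divn N :
  \sum_(1 <= d < N.+1) mangoldt R d * (N %/ d)%:R = ln N`!%:R.
Proof.
rewrite ln_factE; transitivity (\sum_(1 <= k < N.+1)
    1 * \sum_(1 <= d < k.+1 | (d %| k)%N) mangoldt R d).
  rewrite (exchange_divisors (mangoldt R) (fun=> 1)); apply: eq_bigr => d _.
  by rewrite sumr_const_nat subn1 /=.
by apply: eq_big_nat => k /andP[k0 _]; rewrite mul1r sum_mangoldt.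
Qed.

Definition psi N : R := \sum_(1 <= k < N.+1) mangoldt R k.

Lemma psi0 : psi 0 = 0. Proof. by rewrite /psi big_geq. Qed.

Lemma psi_subE N M : (N <= M)%N -> psi M - psi N = \sum_(N.+1 <= k < M.+1) mangoldt R k.
Proof. by move=> NM; rewrite /psi (@big_cat_nat _ _ _ N.+1) //= addrAC subrr add0r. Qed.

Lemma psi_mono N M : (N <= M)%N -> psi N <= psi M.
Proof.
by move=> NM; rewrite -subr_ge0 psi_subE // sumr_ge0 // => k _; exact: mangoldt_ge0.
Qed.

Lemma psi_ge0 N : 0 <= psi N. Proof. by rewrite -psi0 psi_mono. Qed.

Lemma sum_psi_divn N : \sum_(1 <= e < N.+1) psi (N %/ e) = ln N`!%:R.
Proof.
rewrite -sum_mangoldt_divn.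
transitivity (\sum_(1 <= e < N.+1) 1 * psi (N %/ e)).
  by apply: eq_bigr => e _; rewrite mul1r.
rewrite (exchange_hyperbola (fun=> 1)); apply: eq_bigr => d _.
by rewrite sumr_const_nat subn1 /=.
Qed.

Lemma divn_le_div N k : (0 < k)%N -> (N %/ k)%:R <= N%:R / k%:R :> R.
Proof. by move=> k0; rewrite ler_pdivlMr ?ltr0n // -natrM ler_nat leq_trunc_div. Qed.

Lemma div_lt_divn N k : (0 < k)%N -> N%:R / k%:R < (N %/ k)%:R + 1 :> R.
Proof. by move=> k0; rewrite ltr_pdivrMr ?ltr0n // natr1 -natrM ltr_nat ltn_ceil. Qed.

(* [N/d] - 2 [N/2d] is nonnegative, and it equals 1 when N/2 < d <= N. *)
Lemma psi_half N : (0 < N)%N -> psi N - psi N./2 <= ln N`!%:R - 2 * ln N./2`!%:R.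
Proof.
move=> N0; have hN : (N./2 <= N)%N by rewrite -divn2 leq_div.
rewrite psi_subE // -!sum_mangoldt_divn.
have -> : \sum_(1 <= d < N./2.+1) mangoldt R d * (N./2 %/ d)%:R =
    \sum_(1 <= d < N.+1) mangoldt R d * (N./2 %/ d)%:R.
  rewrite [RHS](@big_cat_nat _ _ _ N./2.+1) //= [X in _ = _ + X]big1_seq ?addr0 //.
  move=> d; rewrite mem_index_iota => /andP[_ /andP[h _]].
  by rewrite divn_small // mulr0.
rewrite mulr_sumr -sumrB [leRHS](@big_cat_nat _ _ _ N./2.+1) //=.
have dN d : (0 < d)%N -> (2 * (N./2 %/ d) <= N %/ d)%N.
  move=> d0; rewrite leq_divRL // -mulnA.
  apply: (@leq_trans (2 * N./2)); first by rewrite leq_mul2l leq_trunc_div orbT.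
  by rewrite mul2n -{2}(odd_double_half N) leq_addl.
have aux d c : mangoldt R d * (N %/ d)%:R - 2 * (mangoldt R d * c%:R) =
    mangoldt R d * ((N %/ d)%:R - (2 * c)%:R).
  by rewrite natrM; ring.
rewrite ler_wpDl //.
  rewrite big_nat_cond sumr_ge0 // => d /andP[/andP[d0 _] _].
  by rewrite aux mulr_ge0 ?mangoldt_ge0 // subr_ge0 ler_nat dN.
apply: ler_sum_nat => d /andP[d1 d2].
rewrite (divn_small d1) mulr0 mulr0 subr0 ler_peMr ?mangoldt_ge0 //.
by rewrite ler1n divn_gt0 // (leq_trans _ d1).
Qed.

(** By Stirling the terms of order [N ln N] cancel up to O(N), since [ln N - ln N./2] is bounded. *)
Lemma ln_fact_half N : (0 < N)%N -> ln N`!%:R - 2 * ln N./2`!%:R <= 5 * N%:R :> R.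
Proof.
move=> N0; have := @ln_fact_upper N N0; have := ln_fact_lower N./2.
have lnN := @ln_le_subr1 N%:R; rewrite ltr0n in lnN; have {}lnN := lnN N0.
have N1 : (1 : R) <= N%:R by rewrite ler1n.
have [m0|] := posnP N./2.
  have -> : N = 1%N by case: N N0 m0 {lnN N1} => [|[|]].
  by rewrite /= ln1; lra.
set m := N./2 => m0.
have m1 : (1 : R) <= m%:R by rewrite ler1n.
have EN : (N%:R : R) = (odd N)%:R + 2 * m%:R.
  by rewrite -natrM -natrD mul2n odd_double_half.
have r1 : (odd N)%:R <= 1 :> R by case: odd; rewrite ?ler01.
have r0 : 0 <= (odd N)%:R :> R by [].
have h : ln (N%:R : R) - ln m%:R <= 2.
  rewrite -ln_div ?posrE ?ltr0n //.
  apply: le_trans (ln_le_subr1 _) _; first by rewrite divr_gt0 ?ltr0n.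
  rewrite lerBlDr ler_pdivrMr ?ltr0n // EN; lra.
have lnm := ln_nat_ge0 R m.
have h2 : (odd N)%:R * ln (N%:R : R) <= ln N%:R.
  by rewrite ler_piMl // ln_nat_ge0.
have h3 : N%:R * ln (N%:R : R) = (odd N)%:R * ln (N%:R : R) + 2 * m%:R * ln N%:R.
  by rewrite {1}EN mulrDl.
have h4 : m%:R * (ln (N%:R : R) - ln m%:R) <= m%:R * 2.
  by rewrite ler_wpM2l //; lra.
rewrite mulrBr in h4.
lra.
Qed.

(** Induction by halving; the constant 10 reproduces itself, as [5 * N + 10 * (N / 2) = 10 * N]. *)
Lemma psi_upper N : psi N <= 10 * N%:R.
Proof.
elim/ltn_ind: N => N IH; have [->|N0] := posnP N; first by rewrite psi0 mulr0.
have hN : (N./2 < N)%N by rewrite -divn2 ltn_Pdiv.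
have := psi_half N0; have := ln_fact_half N0; have := IH _ hN.
have : (2 * N./2)%:R <= N%:R :> R.
  by rewrite ler_nat mul2n -{2}(odd_double_half N) leq_addl.
by rewrite natrM; lra.
Qed.

Lemma mertens_lower N : (0 < N)%N ->
  ln N%:R - 1 <= \sum_(1 <= k < N.+1) mangoldt R k / k%:R.
Proof.
move=> N0; have N0' : (0 : R) < N%:R by rewrite ltr0n.
rewrite -(ler_pM2l N0') mulrBr mulr1.
apply: le_trans (ln_fact_lower N) _.
rewrite -sum_mangoldt_divn mulr_sumr; apply: ler_sum_nat => k /andP[k0 _].
by rewrite mulrCA ler_wpM2l ?mangoldt_ge0 // divn_le_div.
Qed.

(** Replacing [N %/ k] by [N / k] in the formula for [ln N!] costs at most [psi N], which is O(N) by
    Chebyshev's bound. *)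
Lemma mertens_upper N : (0 < N)%N ->
  \sum_(1 <= k < N.+1) mangoldt R k / k%:R <= ln N%:R + 11.
Proof.
move=> N0; have N0' : (0 : R) < N%:R by rewrite ltr0n.
rewrite -(ler_pM2l N0').
have h : N%:R * \sum_(1 <= k < N.+1) mangoldt R k / k%:R <= ln N`!%:R + psi N.
  rewrite -sum_mangoldt_divn /psi -big_split mulr_sumr /=.
  apply: ler_sum_nat => k /andP[k0 _].
  rewrite mulrCA -[X in _ <= _ + X]mulr1 -mulrDr ler_wpM2l ?mangoldt_ge0 //.
  exact/ltW/div_lt_divn.
apply: le_trans h _.
have := ln_fact_upper N0; have := psi_upper N.
have N1 : (1 : R) <= N%:R by rewrite ler1n.
have lnN := @ln_le_subr1 N%:R N0'; lra.
Qed.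

End Chebyshev.

(** * Selberg's formula *)

Section Selberg.
Variable R : realType.
Implicit Types (N M n k d e : nat) (x y t K : R).
Local Notation psi := (psi R).
Local Notation mangoldt := (mangoldt R).

Let harm n : R := \sum_(1 <= k < n.+1) k%:R^-1.

(** The sequence [harm n - ln n] decreases, and it increases once [1 / n] is subtracted; the
    supremum of the second sequence separates the two. *)
Lemma euler_constant : exists g : R, 0 <= g <= 1 /\
  forall n, (0 < n)%N -> g <= harm n - ln n%:R <= g + n%:R^-1.
Proof.
pose b n : R := harm n.+1 - ln n.+1%:R.
pose a n : R := b n - n.+1%:R^-1.
have pos n : (0 : R) < n.+1%:R by rewrite ltr0n.
have bE n : b n.+1 = b n + n.+2%:R^-1 - (ln n.+2%:R - ln n.+1%:R).
  by rewrite /b /harm [X in X - _ = _]big_nat_recr //=; ring.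
have b_noninc : {homo b : i j / (i <= j)%N >-> j <= i}.
  apply: homo_leq => // [x y z|n]; first by move=> h1 h2; exact: le_trans h2 h1.
  rewrite bE; have := @ln_succ_lower R n.+1 isT.
  by rewrite -ler_pdivrMl // mulr1 -addrA gerDl subr_le0.
have a_nondec : {homo a : i j / (i <= j)%N >-> i <= j}.
  apply: homo_leq => // [x y z|n]; first exact: le_trans.
  rewrite /a bE; have := @ln_succ_upper R n.+1 isT.
  rewrite -ler_pdivlMl // mulr1.
  by move: (_^-1) (_^-1) (ln _) (ln _) => u v w z; lra.
have ab m n : a m <= b n.
  have abk k : a k <= b k by rewrite /a gerBl invr_ge0.
  have [mn|/ltnW nm] := leqP m n.
    exact: le_trans (a_nondec _ _ mn) (abk n).
  exact: le_trans (abk m) (b_noninc _ _ nm).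
pose A : set R := fun x => exists n, x = a n.
have A0 : nonempty A by exists (a 0%N), 0%N.
have supA : has_sup A by split=> //; exists (b 0%N) => _ [n ->].
have a_le n : a n <= sup A by apply: sup_upper_bound => //; exists n.
have le_b n : sup A <= b n by apply: ge_sup => // _ [m ->].
exists (sup A); split.
  have := a_le 0%N; have := le_b 0%N.
  by rewrite /a /b /harm big_nat1 ln1 invr1 subr0 subrr => -> ->.
by case=> // n _; rewrite le_b -lerBlDr a_le.
Qed.

Lemma sum_ln_sub N : \sum_(1 <= d < N.+1) (ln N%:R - ln d%:R) <= N%:R :> R.
Proof.
rewrite sumrB -ln_factE sumr_const_nat subn1 /= -[_ *+ N]mulr_natl.
by have := ln_fact_lower R N; lra.
Qed.

Lemma sum_ln_sub_sqr N : \sum_(1 <= d < N.+1) (ln N%:R - ln d%:R) ^+ 2 <= 3 * N%:R :> R.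
Proof.
elim: N => [|[|N] IH]; first by rewrite big_geq // mulr0.
  by rewrite big_nat1 subrr expr0n /= mulr1.
rewrite big_nat_recr //= subrr expr0n /= addr0.
set u := ln N.+2%:R - ln (N.+1%:R : R).
have N0 : (0 : R) < N.+1%:R by rewrite ltr0n.
have u0 : 0 <= u by rewrite subr_ge0 ler_ln_nat.
have u1 : N.+1%:R * u <= 1 by exact: ln_succ_upper.
(* The squares are expanded around [ln N.+1]. As [N.+1 * u <= 1], the cross term adds at most 2 and
   the last term at most 1, hence the factor 3. *)
have -> : \sum_(1 <= d < N.+2) (ln N.+2%:R - ln (d%:R : R)) ^+ 2 =
    \sum_(1 <= d < N.+2) (ln N.+1%:R - ln (d%:R : R)) ^+ 2 +
    2 * u * \sum_(1 <= d < N.+2) (ln N.+1%:R - ln d%:R) + N.+1%:R * u ^+ 2.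
  have -> : N.+1%:R * u ^+ 2 = \sum_(1 <= d < N.+2) u ^+ 2.
    by rewrite sumr_const_nat subn1 /= mulr_natl.
  rewrite mulr_sumr -!big_split /=; apply: eq_bigr => d _; rewrite /u; ring.
have h1 := ler_wpM2l u0 (sum_ln_sub N.+1).
have u2 : u <= 1.
  by apply: le_trans u1; rewrite ler_peMl // ler1n.
have h2 : N.+1%:R * u ^+ 2 <= 1.
  rewrite expr2 mulrA; apply: le_trans (ler_wpM2r u0 u1) _.
  by rewrite mul1r.
rewrite -[N.+2%:R]natr1; lra.
Qed.

(** Moebius inversion with the weight [ln (N / d)]: over the divisors of [k], the weighted Moebius
    sum is [ln N] times the indicator of [k = 1], plus [mangoldt k]. *)
Lemma tatuzawa_iseki (h : nat -> R) N : (0 < N)%N ->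
  ln N%:R * h 1%N + \sum_(1 <= k < N.+1) mangoldt k * h k =
  \sum_(1 <= d < N.+1) (moebius d)%:~R * (ln N%:R - ln d%:R) *
     \sum_(1 <= e < (N %/ d).+1) h (d * e)%N.
Proof.
move=> N0; rewrite -exchange_divisors.
have E k : (0 < k)%N ->
    \sum_(1 <= d < k.+1 | (d %| k)%N) (moebius d)%:~R * (ln N%:R - ln d%:R) =
    ln N%:R * (k == 1%N)%:R + mangoldt k.
  move=> k0; rewrite -sum_moebius // -[mangoldt k]opprK -sum_moebius_ln //.
  by rewrite mulr_sumr -sumrB; apply: eq_bigr => d _; ring.
transitivity (\sum_(1 <= k < N.+1) (h k * (ln N%:R * (k == 1%N)%:R) + mangoldt k * h k)).
  rewrite big_split /=; congr (_ + _).
  rewrite big_ltn // eqxx mulr1 big1_seq ?addr0 1?mulrC //.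
  by move=> k; rewrite mem_index_iota => /andP[_ /andP[k2 _]]; rewrite gtn_eqF // !mulr0.
by apply: eq_big_nat => k /andP[k0 _]; rewrite E // mulrDr [h k * mangoldt k]mulrC.
Qed.

(* The summand is F (N / (d e)) for F t = psi t - t + 1 + g; the constant 1 + g,
   with g Euler's constant, cancels the linear term of the sum over e. *)
Lemma psi_remainder_sum_bound (g : R) N d :
  0 <= g <= 1 -> (forall n, (0 < n)%N -> g <= harm n - ln n%:R <= g + n%:R^-1) ->
  (0 < d)%N -> (d <= N)%N ->
  `|\sum_(1 <= e < (N %/ d).+1)
     (psi (N %/ (d * e)) - N%:R / (d * e)%:R + (1 + g))| <= 3 + (ln N%:R - ln d%:R).
Proof.
move=> /andP[g0 g1] gP d0 dN; set m := (N %/ d)%N; set y : R := N%:R / d%:R.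
have m0 : (0 < m)%N by rewrite divn_gt0.
have m0' : (0 : R) < m%:R by rewrite ltr0n.
have -> : \sum_(1 <= e < m.+1) (psi (N %/ (d * e)) - N%:R / (d * e)%:R + (1 + g)) =
    ln m`!%:R - y * harm m + (1 + g) * m%:R.
  rewrite big_split sumrB /= -sum_psi_divn; congr (_ - _ + _).
  - by apply: eq_bigr => e _; rewrite divnMA.
  - by rewrite /harm mulr_sumr; apply: eq_bigr => e _; rewrite natrM invfM mulrA.
  - by rewrite sumr_const_nat subn1 /= mulr_natr.
have y1 : m%:R <= y by exact: divn_le_div.
have y2 : y <= m%:R + 1 by exact/ltW/div_lt_divn.
have /andP[r0 r1] := gP m m0.
(* After Stirling, only [(y - m) * ln m], [(y - m) * g], [y * r] and a remainder O(1 + ln m)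
   survive; here [y - m] is at most 1 and [y * r] at most 2. *)
set r := harm m - ln m%:R - g.
have -> : harm m = ln m%:R + g + r by rewrite /r; ring.
have {}r0 : 0 <= r by rewrite /r; lra.
have {}r1 : m%:R * r <= 1.
  by rewrite -ler_pdivlMl // mulr1 /r; lra.
have r2 : r <= 1 by apply: le_trans r1; rewrite ler_peMl // ler1n.
have yr0 : 0 <= y * r by rewrite mulr_ge0 // (le_trans _ y1) // ltW.
have yr : y * r <= 2.
  apply: le_trans (ler_wpM2r r0 y2) _; rewrite mulrDl mul1r; lra.
have yg0 : 0 <= (y - m%:R) * g by rewrite mulr_ge0 // subr_ge0.
have yg1 : (y - m%:R) * g <= 1.
  by rewrite -[leRHS]mulr1 ler_pM //; lra.
have lm0 := ln_nat_ge0 R m.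
have yl0 : 0 <= (y - m%:R) * ln m%:R by rewrite mulr_ge0 // subr_ge0.
have yl1 : (y - m%:R) * ln m%:R <= ln m%:R.
  by rewrite ler_piMl //; lra.
have lmu : ln m%:R <= ln N%:R - ln (d%:R : R).
  rewrite -ln_div ?posrE ?ltr0n //; last exact: leq_trans dN.
  by rewrite ler_ln ?posrE // (lt_le_trans m0' y1).
have := @ln_fact_upper R m m0; have := ln_fact_lower R m.
rewrite !mulrBl in yg0 yg1 yl0 yl1.
by move=> f1 f2; rewrite ler_norml; apply/andP; split; lra.
Qed.

(** The identity [tatuzawa_iseki] is applied to the remainder of psi. Its right side is O(N) by the
    sums of [ln (N / d)] and of its square; on the left, Mertens' estimate supplies the second
    [N ln N]. *)
Lemma selberg_formula N : (0 < N)%N ->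
  `|ln N%:R * psi N + \sum_(1 <= k < N.+1) mangoldt k * psi (N %/ k)
    - 2 * N%:R * ln N%:R| <= 30 * N%:R.
Proof.
move=> N0; have [g [g01 gP]] := euler_constant.
have := @tatuzawa_iseki (fun k => psi (N %/ k) - N%:R / k%:R + (1 + g)) N N0.
set S := (X in _ = X) => ES.
have bS : `|S| <= 6 * N%:R.
  rewrite /S; apply: le_trans (ler_norm_sum _ _ _) _.
  apply: (@le_trans _ _ (\sum_(1 <= d < N.+1)
    ((ln N%:R - ln d%:R) * 3 + (ln N%:R - ln (d%:R : R)) ^+ 2))).
    apply: ler_sum_nat => d /andP[d0 dN]; rewrite ltnS in dN.
    have u0 : 0 <= ln N%:R - ln (d%:R : R) by rewrite subr_ge0 ler_ln_nat.
    rewrite expr2 -mulrDr normrM; apply: ler_pM => //.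
      rewrite normrM (ger0_norm u0) ler_piMl // -intr_norm lerz1.
      exact: moebius_norm.
    exact: psi_remainder_sum_bound.
  rewrite big_split -mulr_suml /=.
  by have := sum_ln_sub N; have := sum_ln_sub_sqr N; lra.
move: ES; rewrite divn1 divr1.
have -> : \sum_(1 <= k < N.+1) mangoldt k * (psi (N %/ k) - N%:R / k%:R + (1 + g)) =
    \sum_(1 <= k < N.+1) mangoldt k * psi (N %/ k)
    - N%:R * \sum_(1 <= k < N.+1) mangoldt k / k%:R + (1 + g) * psi N.
  have -> : (1 + g) * psi N = \sum_(1 <= k < N.+1) (1 + g) * mangoldt k by exact: mulr_sumr.
  rewrite mulr_sumr -sumrB -big_split /=; apply: eq_bigr => k _; ring.
have N0' : (0 : R) < N%:R by rewrite ltr0n.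
have := ler_wpM2l (ltW N0') (@mertens_upper R N N0).
have := ler_wpM2l (ltW N0') (@mertens_lower R N N0).
set T := \sum_(1 <= k < N.+1) mangoldt k * psi (N %/ k).
set V := \sum_(1 <= k < N.+1) _ => mL mU ES.
move: bS; rewrite ler_norml => /andP[S1 S2].
move/andP: g01 => [g0 g1].
have p0 := @psi_ge0 R N; have p1 := psi_upper R N.
have gp0 : 0 <= g * psi N by rewrite mulr_ge0.
have gp1 : g * psi N <= psi N by rewrite ler_piMl.
have l0 := ln_nat_ge0 R N.
have l1 := @ln_le_subr1 R N%:R N0'.
have gl0 : 0 <= g * ln N%:R by rewrite mulr_ge0.
have gl1 : g * ln N%:R <= ln N%:R by rewrite ler_piMl.
by rewrite ler_norml; apply/andP; split; lra.
Qed.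

End Selberg.

(** * Increments of psi *)

Section Intervals.
Variable R : realType.
Implicit Types (N M n k d e X : nat) (x y t K eps : R).
Local Notation psi := (psi R).
Local Notation mangoldt := (mangoldt R).

Lemma eventually_le_nat (c : R) : exists2 X, (0 < X)%N &
  forall N, (X <= N)%N -> c <= N%:R.
Proof.
exists (Num.truncn c).+1 => // N XN.
by apply: le_trans (ltW (truncnS_gt c)) _; rewrite ler_nat.
Qed.

Lemma eventually_le_ln (c : R) : exists2 X, (0 < X)%N &
  forall N, (X <= N)%N -> c <= ln N%:R.
Proof.
have [X X0 h] := eventually_le_nat (expR c); exists X => // N XN.
have N0 : (0 < N)%N by exact: leq_trans XN.
by rewrite -[c]expRK ler_ln ?posrE ?expR_gt0 ?ltr0n // h.
Qed.

Lemma ln_sub_le N M K : (0 < N)%N -> (0 < M)%N -> M%:R <= K * N%:R ->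
  ln M%:R <= ln N%:R + ln K.
Proof.
move=> N0 M0 MK; have N0' : (0 : R) < N%:R by rewrite ltr0n.
have K0 : 0 < K.
  by rewrite -(pmulr_lgt0 _ N0') (lt_le_trans _ MK) // ltr0n.
rewrite addrC -lnM ?posrE // ler_ln ?posrE ?mulr_gt0 ?ltr0n //.
Qed.

(** Difference of Selberg's formula at [M] and at [N]; since [M <= K * N], writing [ln N] for [ln M]
    costs only O(N). *)
Lemma selberg_interval K : 1 <= K -> exists B : R,
  forall N M, (0 < N)%N -> (N <= M)%N -> M%:R <= K * N%:R ->
  `|ln N%:R * (psi M - psi N)
    + \sum_(1 <= k < M.+1) mangoldt k * (psi (M %/ k) - psi (N %/ k))
    - 2 * (M%:R - N%:R) * ln N%:R| <= B * N%:R.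
Proof.
(* The first two terms come from the formula at [N] and at [M]; [12 * K ^+ 2] bounds the change of
   logarithm, 10 from [psi M] and 2 from [2 * M]. *)
move=> K1; exists (30 + 30 * K + 12 * K ^+ 2) => N M N0 NM MK.
have M0 : (0 < M)%N by exact: leq_trans NM.
have N0' : (0 : R) < N%:R by rewrite ltr0n.
have -> : \sum_(1 <= k < M.+1) mangoldt k * (psi (M %/ k) - psi (N %/ k)) =
    \sum_(1 <= k < M.+1) mangoldt k * psi (M %/ k) -
    \sum_(1 <= k < N.+1) mangoldt k * psi (N %/ k).
  have -> : \sum_(1 <= k < N.+1) mangoldt k * psi (N %/ k) =
      \sum_(1 <= k < M.+1) mangoldt k * psi (N %/ k).
    rewrite [RHS](@big_cat_nat _ _ _ N.+1) //= [X in _ = _ + X]big1_seq ?addr0 //.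
    move=> d; rewrite mem_index_iota => /andP[_ /andP[h _]].
    by rewrite divn_small // psi0 mulr0.
  by rewrite -sumrB; apply: eq_bigr => k _; rewrite mulrBr.
have := selberg_formula R M0; have := selberg_formula R N0.
rewrite !ler_norml => /andP[n1 n2] /andP[m1 m2].
set D := ln (M%:R : R) - ln N%:R.
have D0 : 0 <= D by rewrite subr_ge0 ler_ln_nat.
have DK : D <= K.
  have := ln_sub_le N0 M0 MK; have := @ln_le_subr1 R K; rewrite /D; lra.
have pM0 := psi_ge0 R M; have pM1 := psi_upper R M.
have K0 : 0 <= K by lra.
have Dp0 : 0 <= D * psi M by rewrite mulr_ge0.
have Dp1 : D * psi M <= 10 * (K ^+ 2 * N%:R).
  apply: le_trans (ler_pM D0 pM0 DK pM1) _.
  by have := ler_wpM2l K0 MK; rewrite expr2 mulrA; lra.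
have DM0 : 0 <= D * M%:R by rewrite mulr_ge0.
have DM1 : D * M%:R <= K ^+ 2 * N%:R.
  by rewrite expr2 -mulrA; apply: ler_pM.
have K2 : 0 <= K ^+ 2 * N%:R by rewrite mulr_ge0 // ?exprn_ge0 // ltW.
rewrite !mulrBl in Dp0 Dp1 DM0 DM1.
by apply/andP; split; lra.
Qed.

Lemma sum_mangoldt_increment_ge0 N M : (N <= M)%N ->
  0 <= \sum_(1 <= k < M.+1) mangoldt k * (psi (M %/ k) - psi (N %/ k)).
Proof.
move=> NM; apply: sumr_ge0 => k _.
by rewrite mulr_ge0 ?mangoldt_ge0 // subr_ge0 psi_mono // leq_div2r.
Qed.

(** The convolution sum in [selberg_interval] is nonnegative; dropping it and dividing by [ln N]
    gives upper density 2. *)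
Lemma psi_increment_upper K eps : 1 <= K -> 0 < eps -> exists2 X, (0 < X)%N &
  forall N M, (X <= N)%N -> (N <= M)%N -> M%:R <= K * N%:R ->
  psi M - psi N <= 2 * (M%:R - N%:R) + eps * N%:R.
Proof.
move=> K1 e0; have [B BP] := selberg_interval K1.
have [X1 X10 X1P] := eventually_le_ln (Num.max 1 (B / eps)).
exists X1 => // N M XN NM MK; have N0 : (0 < N)%N by exact: leq_trans XN.
have N0' : (0 : R) < N%:R by rewrite ltr0n.
have := X1P N XN; rewrite ge_max => /andP[l1 l2].
have := BP N M N0 NM MK; rewrite ler_norml => /andP[_ h].
have := sum_mangoldt_increment_ge0 NM => h0.
have {}l2 : B <= eps * ln N%:R by rewrite -ler_pdivrMl // mulrC.
have l0 : 0 < ln (N%:R : R) by lra.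
rewrite -(ler_pM2l l0).
have := ler_wpM2r (ltW N0') l2; lra.
Qed.

(** If [k0] and [k1] are the least and greatest good integers, the mass is at most the growth of psi
    on [k0, k1] divided by [k0]. That is about [2 * eta]; the factor 4 absorbs the errors. *)
Lemma cluster_window (eta : R) : 0 < eta -> exists2 X, (0 < X)%N &
  forall (good : pred nat) a b, (X <= a)%N -> (a <= b)%N ->
  (forall k1 k2, (a < k1)%N -> (k1 <= k2)%N -> (k2 <= b)%N ->
    good k1 -> good k2 -> k2%:R < (1 + eta) * k1%:R) ->
  \sum_(a.+1 <= k < b.+1 | good k) mangoldt k / k%:R <= 4 * eta.
Proof.
move=> e0; have K1 : 1 <= 2 * (1 + eta) by lra.
have [X X0 XP] := psi_increment_upper K1 e0.
have [Y Y0 YP] := eventually_le_nat (2 / eta).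
exists (maxn X (maxn 1 Y)); first by rewrite leq_max X0.
move=> good a b; rewrite !geq_max => /and3P[Xa a1 Ya] ab gP.
pose P k := [&& (a < k)%N, (k <= b)%N & good k].
case: (boolP (has good (index_iota a.+1 b.+1))) => [/hasP[k' ]|/hasPn nogood]; last first.
  by rewrite big1_seq => [|k /andP[gk /nogood]]; rewrite ?gk // mulr_ge0 // ltW.
rewrite mem_index_iota ltnS => /andP[k'1 k'2] gk'.
have exP : exists k, P k by exists k'; rewrite /P k'1 k'2.
have Pb k : P k -> (k <= b)%N by case/and3P.
have [k0 /and3P[ak0 k0b gk0] k0min] := ex_minnP exP.
have [k1 /and3P[ak1 k1b gk1] k1max] := ex_maxnP exP Pb.
have k01 : (k0 <= k1)%N by apply: k1max; rewrite /P ak0 k0b.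
have k0pos : (0 < k0)%N by exact: leq_ltn_trans ak0.
have k0pos' : (0 : R) < k0%:R by rewrite ltr0n.
have kk := gP _ _ ak0 k01 k1b gk0 gk1.
rewrite (@big_cat_nat _ _ _ k0) //=; last by rewrite ltnW.
rewrite big1_seq ?add0r; last first.
  move=> k; rewrite mem_index_iota => /andP[gk /andP[ak kk0]].
  have := k0min k; rewrite /P ak gk (leq_trans (ltnW kk0)) //= => /(_ isT).
  by rewrite leqNgt kk0.
rewrite (@big_cat_nat _ _ _ k1.+1) //=; last by rewrite ltnW.
rewrite [X in _ + X]big1_seq ?addr0; last first.
  move=> k; rewrite mem_index_iota => /andP[gk /andP[k1k kb]].
  have := k1max k; rewrite /P gk (ltn_trans ak1 k1k) -ltnS kb => /(_ isT).
  by rewrite leqNgt k1k.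
apply: (@le_trans _ _ (\sum_(k0 <= k < k1.+1) mangoldt k / k0%:R)).
  rewrite big_mkcond; apply: ler_sum_nat => k /andP[k0k _].
  have le1 : mangoldt k / k%:R <= mangoldt k / k0%:R.
    rewrite ler_wpM2l ?mangoldt_ge0 // lef_pV2 ?posrE ?ltr0n ?ler_nat //.
    exact: leq_trans k0k.
  by case: ifP => // _; rewrite mulr_ge0 ?mangoldt_ge0 ?invr_ge0.
rewrite -mulr_suml.
have -> : \sum_(k0 <= k < k1.+1) mangoldt k = psi k1 - psi k0.-1.
  by rewrite psi_subE ?prednK // (leq_trans (leq_pred _)).
have k0E : (k0%:R : R) = k0.-1%:R + 1 by rewrite natr1 prednK.
have ak0' : (a <= k0.-1)%N by rewrite -ltnS prednK.
have k0p1 : 1 <= k0.-1%:R :> R by rewrite ler1n (leq_trans _ ak0').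
have := XP k0.-1 k1 (leq_trans Xa ak0') (leq_trans (leq_pred _) k01).
have ek : eta <= eta * k0.-1%:R by rewrite ler_peMr // ltW.
have ee : 2 <= eta * k0%:R.
  by rewrite -ler_pdivrMl // mulrC YP // (leq_trans Ya) // (leq_trans ak0') ?leq_pred.
rewrite ler_pdivrMr // => h.
have /h : k1%:R <= 2 * (1 + eta) * k0.-1%:R by move: kk; rewrite k0E; lra.
move: kk ee; rewrite k0E; lra.
Qed.

(* The good k in a window (T / lam, T] lie within a factor 1 + ln lam / 8 of each
   other; as psi has density at most 2, they carry at most half of the mass
   ln lam of the window. *)
Lemma cluster_mass (lam : R) : 1 < lam -> exists C : R,
  forall (good : pred nat) T, (0 < T)%N ->
  (forall k1 k2, (0 < k1)%N -> (k1 <= k2)%N -> (k2 <= T)%N ->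
    good k1 -> good k2 -> k2%:R <= lam * k1%:R -> k2%:R < (1 + ln lam / 8) * k1%:R) ->
  \sum_(1 <= k < T.+1 | good k) mangoldt k / k%:R <= C + ln T%:R / 2.
Proof.
move=> lam1; have lam0 : 0 < lam by lra.
have e0 : 0 < ln lam / 8 by rewrite divr_gt0 // ln_gt0.
have [X X0 XP] := cluster_window e0.
have [Y Y0 YP] := eventually_le_nat (lam * X%:R).
exists (ln Y%:R + 11) => good; elim/ltn_ind => T IH T0 gP.
have lT := ln_nat_ge0 R T.
have [TY|/ltnW YT] := leqP T Y.
  apply: (@le_trans _ _ (ln T%:R + 11)).
    apply: le_trans _ (mertens_upper R T0); rewrite big_mkcond.
    apply: ler_sum_nat => k _; case: ifP => // _.
    by rewrite mulr_ge0 ?mangoldt_ge0 ?invr_ge0.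
  by have := ler_ln_nat R T0 TY; lra.
have T0' : (0 : R) < T%:R by rewrite ltr0n.
have Tl0 : 0 <= T%:R / lam by rewrite divr_ge0 // ltW.
have /andP[T'1 T'2] := truncn_itv Tl0.
set T' := Num.truncn (T%:R / lam) in T'1 T'2.
have XT' : (X <= T')%N.
  rewrite /T' truncn_ge_nat // ler_pdivlMr // mulrC; exact: YP.
have T'0 : (0 < T')%N by exact: leq_trans XT'.
have T'T : (T' < T)%N.
  rewrite -(ltr_nat R); apply: le_lt_trans T'1 _.
  by rewrite ltr_pdivrMr // ltr_pMr.
rewrite (@big_cat_nat _ _ _ T'.+1) //=; last by rewrite ltnS ltnW.
have h1 : \sum_(1 <= k < T'.+1 | good k) mangoldt k / k%:R <= ln Y%:R + 11 + ln T'%:R / 2.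
  apply: IH => // k1 k2 k10 k12 k2T'; apply: gP => //.
  by rewrite (leq_trans k2T') // ltnW.
(* The choice of 8 makes this bound half of [ln lam], which the drop from [ln T] to [ln T'] pays for
   in the induction. *)
have h2 : \sum_(T'.+1 <= k < T.+1 | good k) mangoldt k / k%:R <= 4 * (ln lam / 8).
  apply: XP => //; first exact: ltnW.
  move=> k1 k2 T'k1 k12 k2T g1 g2; apply: gP => //; first exact: leq_ltn_trans T'k1.
  have : T%:R < lam * k1%:R.
    rewrite -ltr_pdivrMl // mulrC; apply: lt_le_trans T'2 _.
    by rewrite ler_nat.
  have : k2%:R <= T%:R :> R by rewrite ler_nat.
  lra.
have h3 : ln T'%:R <= ln T%:R - ln lam.
  by rewrite -ln_div ?posrE // ler_ln ?posrE ?ltr0n ?divr_gt0.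
lra.
Qed.

End Intervals.

(** * Erdos's argument *)

Section SparseIntervals.
Variable R : realType.
Implicit Types (N M n k d e X : nat) (x y t K eps lam dl : R).
Local Notation psi := (psi R).
Local Notation mangoldt := (mangoldt R).

(** The negation gives psi a fixed proportion of growth on all far intervals of ratio above [lam].
    No upper bound is put on [M]; [sparse_short] provides one. *)
Definition sparse lam := forall eps X, 0 < eps ->
  exists N M, [/\ (X <= N)%N, lam * N%:R < M%:R & psi M - psi N <= eps * N%:R].

(** As psi is monotone, [M] may be lowered to the first integer above [lam * N]; Selberg's formula
    on intervals requires bounded ratio. *)
Lemma sparse_short lam eps X : 1 < lam -> sparse lam -> 0 < eps -> (0 < X)%N ->
  exists N M, [/\ (X <= N)%N, (N <= M)%N, lam * N%:R < M%:R, M%:R <= 2 * lam * N%:R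
    & psi M - psi N <= eps * N%:R].
Proof.
move=> l1 sp e0 X0; have [N [M [XN h1 h2]]] := sp eps X e0.
have N1 : (1 : R) <= N%:R by rewrite ler1n (leq_trans X0).
have lN0 : N%:R <= lam * N%:R by rewrite ler_peMl // ltW.
have /andP[t1 t2] := truncn_itv (le_trans (le_trans ler01 N1) lN0).
set M' := (Num.truncn (lam * N%:R)).+1 in t2 *.
have M'M : (M' <= M)%N by rewrite -(ltr_nat R); exact: le_lt_trans t1 h1.
exists N, M'; split=> //.
- by rewrite -(ler_nat R) (le_trans lN0) // ltW.
- rewrite /M' -natr1; lra.
- by apply: le_trans h2; rewrite lerB // psi_mono.
Qed.

Lemma psi_increment_scaled_upper K eps : 1 <= K -> 0 < eps -> exists2 X, (0 < X)%N &
  forall N M k, (0 < k)%N -> (X <= N %/ k)%N -> (N <= M)%N -> M%:R <= K * N%:R ->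
  psi (M %/ k) - psi (N %/ k) <= (2 * (M%:R - N%:R) + eps * N%:R) / k%:R.
Proof.
move=> K1 e0; have e20 : 0 < eps / 2 by rewrite divr_gt0.
have K21 : 1 <= 2 * K by lra.
have [X X0 XP] := psi_increment_upper K21 e20.
(* Rounding [N / k] down adds at most 2 to twice the length, which is at most [eps / 2 * (N %/ k)]
   from here on. *)
have [Y Y0 YP] := eventually_le_nat (4 / eps).
exists (maxn X Y); first by rewrite leq_max X0.
move=> N M k k0; rewrite geq_max => /andP[Xn Yn] NM MK.
have k0' : (0 : R) < k%:R by rewrite ltr0n.
have n1 : (1 : R) <= (N %/ k)%:R by rewrite ler1n (leq_trans X0).
have m1 := divn_le_div R M k0.
have n2 := divn_le_div R N k0.
have n3 := div_lt_divn R N k0.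
have en : 4 <= eps * (N %/ k)%:R by rewrite mulrC -ler_pdivrMr // YP.
have MKk : M%:R / k%:R <= K * (N%:R / k%:R).
  by rewrite mulrA ler_pM2r // invr_gt0.
have h : (M %/ k)%:R <= 2 * K * (N %/ k)%:R.
  have := ler_wpM2l (le_trans ler01 K1) (ltW n3).
  have := ler_wpM2l (le_trans ler01 K1) n1; lra.
apply: le_trans (XP _ _ Xn (leq_div2r _ NM) h) _.
have := ler_wpM2l (ltW e0) n2; lra.
Qed.

Lemma divn_ge_half N k : (0 < k)%N -> (k <= N)%N -> N%:R / k%:R <= 2 * (N %/ k)%:R :> R.
Proof.
move=> k0 kN; have := div_lt_divn R N k0.
have : (1 : R) <= (N %/ k)%:R by rewrite ler1n divn_gt0.
lra.
Qed.

Lemma ln_divn_lower N X : (0 < X)%N -> (X <= N)%N ->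
  ln N%:R - ln (2 * X%:R) <= ln (N %/ X)%:R :> R.
Proof.
move=> X0 XN; have N0 : (0 < N)%N by exact: leq_trans XN.
rewrite lerBlDr -lnM ?posrE ?mulr_gt0 ?ltr0n ?divn_gt0 //.
rewrite ler_ln ?posrE ?mulr_gt0 ?ltr0n ?divn_gt0 //.
have := divn_ge_half X0 XN; rewrite ler_pdivrMr ?ltr0n //; lra.
Qed.

(* By Selberg's formula on a sparse interval (N, M], the increments over
   (N / k, M / k] are nearly maximal, up to a set of k of small logarithmic mass;
   by [cluster_mass] such k cannot avoid the ratios between 1 + ln lam / 8 and lam. *)
Lemma sparse_pair lam dl X : 1 < lam -> sparse lam -> 0 < dl -> (0 < X)%N ->
  exists N M k1 k2, [/\ [/\ (0 < k1)%N, (k1 <= k2)%N, (X <= N %/ k2)%N & (N <= M)%N],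
    lam * N%:R < M%:R, M%:R <= 2 * lam * N%:R,
    k2%:R <= lam * k1%:R /\ (1 + ln lam / 8) * k1%:R <= k2%:R
    & forall k, k = k1 \/ k = k2 ->
      (2 * (M%:R - N%:R) - dl * N%:R) / k%:R <= psi (M %/ k) - psi (N %/ k)].
Proof.
move=> l1 sp dl0 X0; have l0 : 0 < lam by lra.
pose K := 2 * lam; have K1 : 1 <= K by rewrite /K; lra.
pose eps := dl / 16; have e0 : 0 < eps by rewrite divr_gt0.
have [B BP] := @selberg_interval R K K1.
have [Y Y0 YP] := psi_increment_scaled_upper K1 e0.
have [C CP] := cluster_mass l1.
pose Z := maxn X Y; have Z0 : (0 < Z)%N by rewrite leq_max X0.
(* [c2] accounts for [T < k <= M], where [N %/ k] is too small for the asymptotic bounds; [c3]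
   collects all errors of order N. *)
pose c2 := 10 * K * (12 + ln K + ln (2 * Z%:R)).
pose c3 := B + 22 * K + 11 * eps + dl * (ln (2 * Z%:R) / 2 + 1 + C) + c2.
have [W W0 WP] := @eventually_le_ln R (Num.max 1 (4 * c3 / dl)).
have [N [M [XN NM MlN MKN hsp]]] := sparse_short l1 sp e0 (leq_trans Z0 (leq_maxl Z W)).
apply: boolp.contrapT => nopair.
move: XN; rewrite geq_max => /andP[ZN WN].
have N0 : (0 < N)%N by exact: leq_trans ZN.
have M0 : (0 < M)%N by exact: leq_trans NM.
have N0' : (0 : R) < N%:R by rewrite ltr0n.
pose D k := psi (M %/ k) - psi (N %/ k).
pose T := (N %/ Z)%N; have T0 : (0 < T)%N by rewrite divn_gt0.
have TN : (T <= N)%N by exact: leq_div.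
have TM : (T <= M)%N by exact: leq_trans NM.
have ZT k : (0 < k)%N -> (k <= T)%N = (Z <= N %/ k)%N.
  by move=> k0; rewrite !leq_divRL // mulnC.
pose good k := (2 * (M%:R - N%:R) - dl * N%:R) / k%:R <= D k.
have G := CP good T T0; set g := \sum_(1 <= k < T.+1 | _) _ in G.
(* Without the required pair, the good [k] satisfy the clustering hypothesis of [cluster_mass]. *)
have {}G : g <= C + ln T%:R / 2.
  apply: G => k1 k2 k10 k12 k2T g1 g2 k2l; rewrite ltNge; apply/negP => k2m.
  apply: nopair; exists N, M, k1, k2; split=> //.
  - split=> //; apply: (@leq_trans Z); first exact: leq_maxl.
    by rewrite -ZT // (leq_trans k10).
  - by move=> k [->|->].
set H := \sum_(1 <= k < T.+1) mangoldt k / k%:R.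
have H1 : ln T%:R - 1 <= H by exact: mertens_lower.
have H2 : H <= ln T%:R + 11 by exact: mertens_upper.
pose U := 2 * (M%:R - N%:R) + eps * N%:R.
(* Every [k] obeys the upper bound [U / k]; each bad one falls short of it by at least [dl * N / k],
   and the bad ones have mass [H - g]. *)
have S1 : \sum_(1 <= k < T.+1) mangoldt k * D k <= U * H - dl * N%:R * (H - g).
  have -> : U * H - dl * N%:R * (H - g) = \sum_(1 <= k < T.+1)
      (U * (mangoldt k / k%:R) - (dl * N%:R * (mangoldt k / k%:R) -
        dl * N%:R * (if good k then mangoldt k / k%:R else 0))).
    by rewrite /g big_mkcond !sumrB -!mulr_sumr mulrBr.
  apply: ler_sum_nat => k /andP[k0 kT]; rewrite ltnS in kT.
  have k0' : (0 : R) < k%:R by rewrite ltr0n.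
  have kY : (Y <= N %/ k)%N.
    by apply: (@leq_trans Z); [exact: leq_maxr|rewrite -ZT].
  have := YP N M k k0 kY NM MKN; rewrite -/U -/(D k) => DU.
  have L0 := mangoldt_ge0 R k.
  case: ifP => [_|/negbT]; first by have := ler_wpM2l L0 DU; lra.
  rewrite -ltNge => Dg.
  have : D k <= U / k%:R - dl * N%:R / k%:R.
    apply: le_trans (ltW Dg) _; rewrite -mulrBl ler_pM2r ?invr_gt0 // lerB //.
    by rewrite /U lerDl mulr_ge0 // ltW.
  by move/(ler_wpM2l L0); lra.
have HM : \sum_(T.+1 <= k < M.+1) mangoldt k / k%:R <= 12 + ln K + ln (2 * Z%:R).
  have := mertens_upper R M0; rewrite (@big_cat_nat _ _ _ T.+1) //= -/H.
  have := ln_divn_lower Z0 ZN; rewrite -/T; have := ln_sub_le N0 M0 MKN.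
  lra.
have S2 : \sum_(T.+1 <= k < M.+1) mangoldt k * D k <= c2 * N%:R.
  apply: (@le_trans _ _ (10 * M%:R * \sum_(T.+1 <= k < M.+1) mangoldt k / k%:R)).
    rewrite mulr_sumr; apply: ler_sum_nat => k /andP[Tk _].
    have k0 : (0 < k)%N by exact: leq_ltn_trans Tk.
    rewrite mulrCA ler_wpM2l ?mangoldt_ge0 // /D -mulrA.
    have := psi_upper R (M %/ k); have := psi_ge0 R (N %/ k).
    have := divn_le_div R M k0; lra.
  have HM0 : 0 <= \sum_(T.+1 <= k < M.+1) mangoldt k / k%:R.
    by apply: sumr_ge0 => k _; rewrite mulr_ge0 ?mangoldt_ge0 ?invr_ge0.
  have -> : c2 * N%:R = 10 * (K * N%:R) * (12 + ln K + ln (2 * Z%:R)) by rewrite /c2; ring.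
  by rewrite ler_pM ?mulr_ge0 // ler_pM2l.
have := BP N M N0 NM MKN; rewrite ler_norml => /andP[SI _].
move: SI; rewrite (@big_cat_nat _ _ _ T.+1) //=.
set s1 := \sum_(1 <= k < T.+1) _; set s2 := \sum_(T.+1 <= k < M.+1) _ => SI.
have {}S1 : s1 <= U * H - dl * N%:R * (H - g) by exact: S1.
have {}S2 : s2 <= c2 * N%:R by exact: S2.
have l1' := ln_divn_lower Z0 ZN; rewrite -/T in l1'.
have l2' := ler_ln_nat R T0 TN.
set L := ln N%:R in SI l1' l2'.
have L0 : 0 <= L by exact: ln_nat_ge0.
have NM' : N%:R <= M%:R :> R by rewrite ler_nat.
have U0 : 0 <= U by rewrite addr_ge0 // mulr_ge0 ?subr_ge0 // ltW.
have UH : U * H <= U * (L + 11) by rewrite ler_wpM2l //; lra.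
have Hg : L / 2 - (ln (2 * Z%:R) / 2 + 1 + C) <= H - g by lra.
have {}Hg := ler_wpM2l (mulr_ge0 (ltW dl0) (ltW N0')) Hg.
have hL := ler_wpM2l L0 hsp.
(* The bad [k] carry about half of the mass [L], so Selberg's formula loses [dl * L / 2], while its
   other errors amount to [dl * L / 8] plus a constant. *)
have key : N%:R * (dl * L / 2) <= N%:R * ((2 * eps) * L + c3).
  move: S1 S2 SI UH Hg hL MKN; rewrite /c3 /U -/K; lra.
rewrite ler_pM2l // /eps in key.
have := WP N WN; rewrite -/L ge_max ler_pdivrMr // => /andP[L1 hW].
have Lp : 0 < L * dl by rewrite mulr_gt0 //; lra.
lra.
Qed.

(* (N / k2, M / k2] and (N / k1, M / k1] overlap because k2 <= lam k1, and psi
   increases by at most twice the length on the overlap. *)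
Lemma sparse_dense lam lam' eps X : 1 < lam -> lam' < lam * (1 + ln lam / 8) ->
  sparse lam -> 0 < eps -> exists N M,
  [/\ (X <= N)%N, lam' * N%:R < M%:R, M%:R <= 4 * lam ^+ 2 * N%:R
    & 2 * (M%:R - N%:R) - eps * N%:R <= psi M - psi N].
Proof.
move=> l1 ll' sp e0; have l0 : 0 < lam by lra.
set mu := 1 + ln lam / 8 in ll' *.
have mu1 : 1 <= mu by rewrite lerDl divr_ge0 // ltW // ln_gt0.
have lam2 : lam <= lam ^+ 2 by rewrite expr2 ler_peMl // ltW.
have K1 : 1 <= 4 * lam ^+ 2 by lra.
(* Three errors of at most [dl * (lam * (2 * n1))] make up half of [eps * n1]; the other half
   absorbs a rounding error of at most 4. *)
pose dl := eps / (12 * lam); have dl0 : 0 < dl by rewrite divr_gt0 // mulr_gt0.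
have dlE : 12 * (lam * dl) = eps.
  by rewrite mulrA /dl mulrC divfK // gt_eqF // mulr_gt0.
have [Y Y0 YP] := psi_increment_upper K1 dl0.
have [W W0 WP] := @eventually_le_nat R (8 / eps).
have gap0 : 0 < lam * mu - lam' by rewrite subr_gt0.
have [V V0 VP] := @eventually_le_nat R (2 / (lam * mu - lam')).
pose Z := maxn X (maxn Y (maxn W V)).
have Z0 : (0 < Z)%N by rewrite !leq_max Y0 orbT.
have [N [M [k1 [k2 [[k10 k12 ZN NM] MlN MKN [k2l k2m] dP]]]]] := sparse_pair l1 sp dl0 Z0.
have k20 : (0 < k2)%N by exact: leq_trans k12.
have k10' : (0 : R) < k1%:R by rewrite ltr0n.
have k20' : (0 : R) < k2%:R by rewrite ltr0n.
set n1 := (N %/ k2)%N in ZN; set n2 := (N %/ k1)%N.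
set m1 := (M %/ k2)%N; set m2 := (M %/ k1)%N.
have n12 : (n1 <= n2)%N by exact: leq_div2l.
have m12 : (m1 <= m2)%N by exact: leq_div2l.
move: ZN; rewrite !geq_max => /and4P[Xn Yn Wn Vn].
set a : R := N%:R / k2%:R; set b : R := N%:R / k1%:R.
set c : R := M%:R / k2%:R; set d : R := M%:R / k1%:R.
have n1a : n1%:R <= a by exact: divn_le_div.
have an1 : a < n1%:R + 1 by exact: div_lt_divn.
have n2b : n2%:R <= b by exact: divn_le_div.
have bn2 : b < n2%:R + 1 by exact: div_lt_divn.
have m1c : m1%:R <= c by exact: divn_le_div.
have m2d : m2%:R <= d by exact: divn_le_div.
have dm2 : d < m2%:R + 1 by exact: div_lt_divn.
have n11 : 1 <= n1%:R :> R by rewrite ler1n (leq_trans Y0).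
have a0 : 0 <= a by lra.
have Na : a * k2%:R = N%:R by rewrite divfK // gt_eqF.
have Nb : b * k1%:R = N%:R by rewrite divfK // gt_eqF.
have b_la : b <= lam * a.
  by rewrite -(ler_pM2r k10'); have := ler_wpM2l a0 k2l; lra.
have bmu : mu * a <= b.
  by rewrite -(ler_pM2r k10'); have := ler_wpM2l a0 k2m; rewrite -/mu; lra.
have d_lb : lam * b < d by rewrite /b /d mulrA ltr_pM2r ?invr_gt0.
have d_ub : d <= 2 * lam * b by rewrite /b /d mulrA ler_pM2r ?invr_gt0.
have n2m1 : (n2 <= m1)%N.
  rewrite leq_divRL // -(ler_nat R) natrM.
  apply: le_trans (ltW MlN); apply: (@le_trans _ _ (n2%:R * (lam * k1%:R))).
    by rewrite ler_wpM2l.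
  by rewrite mulrCA ler_wpM2l ?(ltW l0) // -natrM ler_nat leq_trunc_div.
exists n1, m2; split=> //.
(* The union has ratio about [d / a], and [d > lam * b >= lam * mu * a]; the gap to [lam'] pays for
   rounding. *)
- have : 2 <= (lam * mu - lam') * n1%:R by rewrite mulrC -ler_pdivrMr // VP.
  have h1 := ler_wpM2l (ltW l0) bmu.
  have h2 : lam * (mu * n1%:R) <= lam * (mu * a).
    by rewrite !ler_wpM2l // ltW // (lt_le_trans ltr01).
  lra.
- have h1 := ler_wpM2l (ltW l0) b_la.
  have h2 : lam * lam * a <= lam * lam * (2 * n1%:R).
    by rewrite ler_wpM2l ?mulr_ge0 ?(ltW l0) //; lra.
  rewrite expr2; lra.
- have := dP k1 (or_introl erefl); have := dP k2 (or_intror erefl).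
  rewrite -/m1 -/m2 -/n1 -/n2 !mulrBl -!(mulrA 2) -!(mulrA dl) !mulrBl -/a -/b -/c -/d => d2 d1.
  have m1K : m1%:R <= 4 * lam ^+ 2 * n2%:R.
    apply: (@le_trans _ _ m2%:R); first by rewrite ler_nat.
    have lb : lam * b <= lam * (2 * n2%:R).
      rewrite ler_wpM2l ?(ltW l0) //.
      have : 1 <= n2%:R :> R by rewrite ler1n (leq_trans Y0) // (leq_trans Yn).
      lra.
    have ln2 : lam * n2%:R <= lam ^+ 2 * n2%:R by rewrite ler_wpM2r.
    lra.
  (* The growth on (n1, m2] is that on the two shrunk intervals minus that on the overlap (n2, m1],
     which is bounded here. *)
  have h := YP n2 m1 (leq_trans Yn n12) n2m1 m1K.
  have e8 : 8 <= eps * n1%:R by rewrite mulrC -ler_pdivrMr // WP.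
  have lb : b <= lam * (2 * n1%:R).
    by apply: le_trans b_la _; rewrite ler_wpM2l ?(ltW l0) ?(ltW dl0) //; lra.
  have da : dl * a <= dl * (lam * (2 * n1%:R)).
    by rewrite ler_wpM2l ?(ltW l0) ?(ltW dl0) //; apply: le_trans lb; apply: le_trans bmu; rewrite ler_peMl.
  have db := ler_wpM2l (ltW dl0) lb.
  have dn2 := ler_wpM2l (ltW dl0) n2b.
  have eE : dl * (lam * (2 * n1%:R)) = eps * n1%:R / 6.
    by rewrite -dlE; field.
  lra.
Qed.

(* When (N, M] has density 2, Selberg's formula leaves o(N ln N) for the sum of
   Lambda k times the increment over (N / k, M / k], so one of these is sparse. *)
Lemma sparse_next lam lam' : 1 < lam -> 1 < lam' -> lam' < lam * (1 + ln lam / 8) ->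
  sparse lam -> sparse lam'.
Proof.
move=> l1 l1' ll' sp eps X e0.
(* The intermediate ratio leaves room for rounding when the endpoints are divided by [k]. *)
have [lam'' [l2 l3]] : exists l, lam' < l /\ l < lam * (1 + ln lam / 8).
  by exists ((lam' + lam * (1 + ln lam / 8)) / 2); split; lra.
pose K := 4 * lam ^+ 2.
have K1 : 1 <= K.
  by have : lam <= lam ^+ 2 by [rewrite expr2 ler_peMl //; lra]; rewrite /K; lra.
have [B BP] := @selberg_interval R K K1.
have gap0 : 0 < lam'' - lam' by rewrite subr_gt0.
have [V V0 VP] := @eventually_le_nat R ((lam'' - lam')^-1).
pose Z := maxn X V; have Z0 : (0 < Z)%N by rewrite leq_max V0 orbT.
pose c := B + eps / 2 * (ln (2 * Z%:R) + 1).
have [W W0 WP] := @eventually_le_ln R (Num.max 1 (8 * c / eps)).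
have e40 : 0 < eps / 4 by rewrite divr_gt0.
have [N [M [XN MlN MKN hd]]] := @sparse_dense lam lam'' (eps / 4) (maxn Z W) l1 l3 sp e40.
move: XN; rewrite geq_max => /andP[ZN WN].
have N0 : (0 < N)%N by exact: leq_trans ZN.
have N0' : (0 : R) < N%:R by rewrite ltr0n.
have lN : N%:R < lam'' * N%:R by rewrite ltr_pMl //; lra.
have NM : (N <= M)%N by rewrite -(ler_nat R) ltW // (lt_trans lN).
apply: boolp.contrapT => none.
pose D k := psi (M %/ k) - psi (N %/ k).
pose T := (N %/ Z)%N; have T0 : (0 < T)%N by rewrite divn_gt0.
have TM : (T <= M)%N by exact: leq_trans (leq_div _ _) NM.
(* Otherwise (N %/ k, M %/ k] would witness [sparse lam'] for the given [eps] and [X]. *)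
have DT k : (0 < k)%N -> (k <= T)%N -> eps / 2 * (N%:R / k%:R) <= D k.
  move=> k0 kT; have k0' : (0 : R) < k%:R by rewrite ltr0n.
  have : (Z <= N %/ k)%N by move: kT; rewrite !leq_divRL // mulnC.
  rewrite geq_max => /andP[Xk Vk].
  have kN : (k <= N)%N by exact: leq_trans kT (leq_div _ _).
  apply: (@le_trans _ _ (eps * (N %/ k)%:R)).
    by have := ler_wpM2l (ltW e0) (divn_ge_half k0 kN); lra.
  rewrite leNgt; apply/negP => Dk; apply: none.
  exists (N %/ k)%N, (M %/ k)%N; split=> //; last exact: ltW.
  have h1 := div_lt_divn R M k0; have h2 := divn_le_div R N k0.
  have h3 : lam'' * (N%:R / k%:R) < M%:R / k%:R by rewrite mulrA ltr_pM2r ?invr_gt0.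
  have h4 : 1 <= (lam'' - lam') * (N %/ k)%:R.
    by rewrite -ler_pdivrMl // mulr1 VP.
  have h5 : lam'' * (N %/ k)%:R <= lam'' * (N%:R / k%:R) by rewrite ler_wpM2l //; lra.
  lra.
have := BP N M N0 NM MKN; rewrite ler_norml => /andP[_].
rewrite (@big_cat_nat _ _ _ T.+1) //=.
set s1 := \sum_(1 <= k < T.+1) _; set s2 := \sum_(T.+1 <= k < M.+1) _ => SI.
have s20 : 0 <= s2.
  apply: sumr_ge0 => k _.
  by rewrite mulr_ge0 ?mangoldt_ge0 // subr_ge0 psi_mono // leq_div2r.
have s1l : eps / 2 * N%:R * (ln T%:R - 1) <= s1.
  apply: (@le_trans _ _ (eps / 2 * N%:R * \sum_(1 <= k < T.+1) mangoldt k / k%:R)).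
    by rewrite ler_wpM2l ?mertens_lower // mulr_ge0 // ltW // divr_gt0.
  rewrite mulr_sumr; apply: ler_sum_nat => k /andP[k0 kT]; rewrite ltnS in kT.
  by have := ler_wpM2l (mangoldt_ge0 R k) (DT k k0 kT); rewrite /D; lra.
have lT := ln_divn_lower Z0 ZN; rewrite -/T in lT.
have eN : 0 <= eps / 2 * N%:R by rewrite mulr_ge0 // ltW // divr_gt0.
have := ler_wpM2l eN lT.
have := WP N WN; rewrite ge_max ler_pdivrMr // => /andP[L1 hW].
set L := ln N%:R in SI lT L1 hW * => h1.
have L0 : 0 <= L by lra.
have h2 := ler_wpM2l L0 hd.
(* The convolution sum exceeds [eps / 2 * N * L] up to O(N), while density 2 within [eps / 4] leaves
   only [eps / 4 * N * L] for it. *)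
have key : N%:R * (eps * L / 4) <= N%:R * c.
  by rewrite /c; lra.
rewrite ler_pM2l // in key.
have Lp : 0 < L * eps by rewrite mulr_gt0 //; lra.
lra.
Qed.

(** Mertens' two estimates give (N, M] logarithmic mass at least [13 - 12 = 1], whereas sparseness
    with [eps = 1 / 2] allows at most one half. *)
Lemma not_sparse_large lam : expR 13 <= lam -> ~ sparse lam.
Proof.
move=> l13 /(_ (1 / 2) 1%N) [|N [M [N0 MlN h]]]; first by rewrite divr_gt0.
have N0' : (0 : R) < N%:R by rewrite ltr0n.
have h13 : expR (13 : R) * N%:R < M%:R by apply: le_lt_trans MlN; rewrite ler_wpM2r.
have e1 : 1 <= expR (13 : R) by have := @expR_ge1Dx R 13; lra.
have NM : (N <= M)%N.
  rewrite -(ler_nat R) ltW //; apply: le_lt_trans _ h13.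
  by rewrite ler_peMl // ltW.
have M0 : (0 < M)%N by exact: leq_trans NM.
have := mertens_upper R N0; have := mertens_lower R M0.
rewrite (@big_cat_nat _ _ _ N.+1) //=.
have : \sum_(N.+1 <= k < M.+1) mangoldt k / k%:R <= (psi M - psi N) / N%:R.
  rewrite psi_subE // mulr_suml; apply: ler_sum_nat => k /andP[Nk _].
  rewrite ler_wpM2l ?mangoldt_ge0 // lef_pV2 ?posrE ?ltr0n ?ler_nat ?(ltnW Nk) //.
  exact: leq_ltn_trans Nk.
have : (psi M - psi N) / N%:R <= 1 / 2 by rewrite ler_pdivrMr.
have : 13 + ln N%:R <= ln M%:R :> R.
  rewrite -{1}[13%R]expRK -lnM ?posrE ?expR_gt0 // ler_ln ?posrE ?mulr_gt0 ?expR_gt0 ?ltr0n //.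
  exact: ltW.
lra.
Qed.

(** Each use of [sparse_next] multiplies the ratio by the fixed factor [r]; this is admissible
    because the logarithm of the ratio never falls below [ln lam]. By Bernoulli's inequality the
    ratio eventually exceeds [expR 13]. *)
Lemma not_sparse lam : 1 < lam -> ~ sparse lam.
Proof.
move=> l1 sp; pose r := 1 + ln lam / 16.
have ll : 0 < ln lam by exact: ln_gt0.
have r1 : 1 < r by rewrite ltrDl divr_gt0.
have l0 : 0 < lam by lra.
have iter n : sparse (lam * r ^+ n).
  elim: n => [|n IH]; first by rewrite expr0 mulr1.
  have rn : 1 <= r ^+ n by rewrite exprn_ege1 // ltW.
  have ln1 : lam <= lam * r ^+ n by rewrite ler_peMr // ltW.
  apply: sparse_next IH; first exact: lt_le_trans ln1.
    by rewrite (lt_le_trans l1) // ler_peMr // ?exprn_ege1 // ltW.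
  rewrite exprSr mulrA ltr_pM2l; last by rewrite (lt_le_trans l0).
  have : ln lam <= ln (lam * r ^+ n) by rewrite ler_ln ?posrE // (lt_le_trans l0).
  by rewrite /r; lra.
have [n n0 nP] := @eventually_le_nat R (expR 13 / (ln lam / 16)).
apply: (@not_sparse_large (lam * r ^+ n)); last exact: iter.
have bern m : 1 + m%:R * (ln lam / 16) <= r ^+ m.
  elim: m => [|m IH]; first by rewrite mul0r addr0 expr0.
  have u0 : 0 <= ln lam / 16 by rewrite divr_ge0 // ltW.
  have h := ler_wpM2r (le_trans ler01 (ltW r1)) IH.
  rewrite exprSr; apply: le_trans h; rewrite -natr1 /r.
  have : 0 <= m%:R * ((ln lam / 16) * (ln lam / 16)) by rewrite mulr_ge0 // mulr_ge0.
  lra.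
have := nP n (leqnn n); rewrite ler_pdivrMr ?divr_gt0 // => h.
have rn0 : r ^+ n <= lam * r ^+ n.
  by rewrite ler_peMl ?(ltW l1) // exprn_ge0 // ltW // (lt_trans ltr01).
have := bern n; lra.
Qed.

End SparseIntervals.

(** * Prime powers *)

Section PrimeFreeIntervals.
Variable R : realType.
Local Notation psi := (psi R).
Local Notation mangoldt := (mangoldt R).

(* The k contributing to psi M - psi N are proper powers p ^ v with p <= s and
   v <= trunc_log 2 M. *)
Lemma psi_prime_free_bound (N M s : nat) : (N <= M)%N ->
  (forall p, (p * p <= M)%N -> (p <= s)%N) ->
  (forall p, (N < p)%N -> (p <= M)%N -> ~~ prime p) ->
  psi M - psi N <= (s * (trunc_log 2 M).+1)%:R * ln M%:R.
Proof.
move=> NM sP noprime; rewrite psi_subE //.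
pose r := [seq k <- index_iota N.+1 M.+1 | size (primes k) == 1%N].
have -> : \sum_(N.+1 <= k < M.+1) mangoldt k = \sum_(k <- r) mangoldt k.
  rewrite /r big_filter [RHS]big_mkcond; apply: eq_bigr => k _.
  by rewrite /mangoldt; case: (primes k) => [|p [|]].
apply: (@le_trans _ _ (\sum_(k <- r) ln M%:R)).
  rewrite big_seq [leRHS]big_seq; apply: ler_sum => k.
  rewrite mem_filter mem_index_iota => /andP[_ /andP[Nk kM]].
  by apply: le_trans (mangoldt_le_ln R k) _; rewrite ler_ln_nat // (leq_ltn_trans _ Nk).
rewrite big_const_seq count_predT iter_addr_0 -[_ *+ size r]mulr_natl.
rewrite ler_wpM2r ?ln_nat_ge0 // ler_nat.
(* A superset of the possible prime powers, in which [p] need not be prime; only its size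
   matters. *)
pose q := [seq (p ^ v)%N | p <- iota 1 s, v <- iota 0 (trunc_log 2 M).+1].
have <- : size q = (s * (trunc_log 2 M).+1)%N by rewrite size_allpairs !size_iota.
apply: uniq_leq_size; first by rewrite filter_uniq // iota_uniq.
move=> k; rewrite mem_filter mem_index_iota => /andP[k1 /andP[Nk kM]].
case E: (primes k) k1 => [|p [|]] // _.
have : p \in primes k by rewrite E mem_head.
rewrite mem_primes => /and3P[pp k0 pk]; have p1 := prime_gt1 pp.
have Ek := primes1_pfactor E.
have v2 : (1 < logn p k)%N.
  have : (0 < logn p k)%N by rewrite logn_gt0 mem_primes pp k0.
  rewrite leq_eqVlt => /orP[/eqP v1|//].
  by move: pp; rewrite -[p]expn1 v1 -Ek (negbTE (noprime _ Nk kM)).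
rewrite ltnS in kM.
apply/allpairsP; exists (p, logn p k); split; last exact: Ek; rewrite mem_iota /=.
  rewrite (ltnW p1) add1n ltnS sP //; apply: leq_trans kM.
  by rewrite mulnn [leqRHS]Ek leq_exp2l.
rewrite add0n ltnS trunc_log_max //; apply: leq_trans kM.
by rewrite [leqRHS]Ek leq_exp2r // (leq_trans _ v2).
Qed.

(** Proper prime powers contribute O(sqrt M (ln M)^2), which is o(M). *)
Lemma psi_prime_free (eps : R) : 0 < eps -> exists2 X, (0 < X)%N &
  forall N M, (X <= M)%N -> (N <= M)%N ->
  (forall p, (N < p)%N -> (p <= M)%N -> ~~ prime p) ->
  psi M - psi N <= eps * M%:R.
Proof.
move=> e0; have [X X0 XP] := @eventually_le_ln R (Num.max 1 (144 / eps)).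
exists X => // N M XM NM noprime; have M0 : (0 < M)%N by exact: leq_trans XM.
have M0' : (0 : R) < M%:R by rewrite ltr0n.
have := XP M XM; set x := ln M%:R; rewrite ge_max ler_pdivrMr // => /andP[x1 xe].
have x0 : 0 <= x by lra.
pose y := expR (x / 2); have y0 : 0 < y by exact: expR_gt0.
have yM : y * y = M%:R by rewrite -expRD -splitr lnK ?posrE.
have sP p : (p * p <= M)%N -> (p <= Num.truncn y)%N.
  move=> pM; rewrite truncn_ge_nat ?(ltW y0) //.
  rewrite -(@ler_pXn2r _ 2) ?nnegrE ?(ltW y0) //.
  by rewrite !expr2 yM -natrM ler_nat.
apply: le_trans (psi_prime_free_bound NM sP noprime) _; rewrite -/x natrM.
have s1 : (Num.truncn y)%:R <= y by have /andP[] := truncn_itv (ltW y0).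
have t1 : (trunc_log 2 M)%:R <= 2 * x :> R.
  have t2 : (2 ^ trunc_log 2 M <= M)%N by exact: trunc_logP.
  have := ler_ln_nat R _ t2; rewrite expn_gt0 natrX lnXn // => /(_ isT).
  rewrite -/x -[_ *+ trunc_log 2 M]mulr_natl.
  have l2 := @ln_ge_1subV R 2 (ltr0Sn _ 1).
  have : (trunc_log 2 M)%:R * (1 / 2) <= (trunc_log 2 M)%:R * ln (2 : R).
    by rewrite ler_wpM2l //; lra.
  lra.
have t3 : (trunc_log 2 M).+1%:R <= 3 * x by rewrite -natr1; lra.
(* The cubic term of the exponential series at [x / 2] bounds [y], the square root of [M]; it beats
   [3 * x * x] once [x >= 144 / eps], with [144 = 3 * 48]. *)
have y3 : x ^+ 3 / 48 <= y.
  have := @expR_ge1Dxn R (x / 2) 2; rewrite divr_ge0 // => /(_ isT).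
  rewrite -/y exprMn; have -> : (3`!)%:R = 6 :> R by [].
  have -> : (2^-1 : R) ^+ 3 = 8^-1 by rewrite exprVn -natrX.
  lra.
have key : 3 * x * x <= eps * y.
  apply: (@le_trans _ _ (eps * (x ^+ 3 / 48))); last by rewrite ler_wpM2l // ltW.
  have := ler_wpM2l (mulr_ge0 x0 x0) xe; rewrite !exprS expr0; lra.
apply: (@le_trans _ _ (y * (3 * x) * x)).
  rewrite ler_wpM2r // ler_pM //.
have := ler_wpM2l (ltW y0) key; rewrite -yM; lra.
Qed.

End PrimeFreeIntervals.

Theorem theorem6p1 (R : realType) (alpha : R)
    (alpha_gt1 : 1 < alpha) (alpha_le2 : alpha <= 2) :
  exists n0 : nat, (0 < n0)%N /\
    forall n : nat, (n0 <= n)%N ->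
      exists p : nat,
        [/\ prime p, (n < p)%N & p%:Z <= Num.floor (alpha * n%:R)].
Proof.
(* A ratio strictly below [alpha], so that the integral part of [alpha * n] still exceeds [lam * n]
   for large [n]. *)
pose lam := (1 + alpha) / 2; have lam1 : 1 < lam by rewrite /lam; lra.
have [eps [X [e0 dense]]] : exists eps X, 0 < eps /\
    forall N M, (X <= N)%N -> lam * N%:R < M%:R -> eps * N%:R < psi R M - psi R N.
  apply: boolp.contrapT => no; apply: (not_sparse lam1) => eps X e0.
  apply: boolp.contrapT => no'; apply: no; exists eps, X; split=> // N M XN NM.
  by rewrite ltNge; apply/negP => h; apply: no'; exists N, M.
have e20 : 0 < eps / 2 by rewrite divr_gt0.
have [Y Y0 YP] := psi_prime_free e20.
have [Z Z0 ZP] := @eventually_le_nat R (1 / (alpha - lam)).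
exists (maxn X (maxn Y Z)); split; first by rewrite !leq_max Y0 orbT.
move=> n; rewrite !geq_max => /and3P[Xn Yn Zn].
have an0 : 0 <= alpha * n%:R by rewrite mulr_ge0 //; lra.
have /andP[m1 m2] := truncn_itv an0; set m := Num.truncn _ in m1 m2.
have gap : 1 <= (alpha - lam) * n%:R.
  by rewrite mulrC -ler_pdivrMr ?ZP // subr_gt0 /lam; lra.
have nm : lam * n%:R < m%:R by move: m2; rewrite -natr1; lra.
have n0 : 0 <= n%:R :> R by [].
have nm' : (n <= m)%N.
  rewrite -(ler_nat R); apply: le_trans (ltW nm); rewrite ler_peMl // ltW //.
apply: boolp.contrapT => none.
have noprime p : (n < p)%N -> (p <= m)%N -> ~~ prime p.
  move=> np pm; apply/negP => pp; apply: none; exists p; split=> //.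
  by rewrite floor_ge_int // -[_%:~R]/(p%:R) (le_trans _ m1) // ler_nat.
have := dense n m Xn nm; have := YP n m (leq_trans Yn nm') nm' noprime.
(* Since [alpha <= 2] gives [m <= 2 * n], the prime-free bound [eps / 2 * m] is at most [eps * n],
   against the growth of psi. *)
have : eps / 2 * m%:R <= eps / 2 * (2 * n%:R).
  rewrite ler_wpM2l //; first exact: ltW.
  by apply: le_trans m1 _; rewrite ler_wpM2r.
lra.
Qed.
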